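(* Let $\mathcal{A}$ be a real, central hyperplane arrangement with fundamental chamber $c_0$. The following are equivalent. (1) The poset of chambers $\mathcal{P}(\mathcal{A},c_0)$ is a crosscut-simplicial lattice. (2) The poset of chambers $\mathcal{P}(\mathcal{A},c_0)$ is a semidistributive lattice. (3) $\mathcal{A}$ (with fundamental chamber $c_0$) is bineighborly.
   Context: A real, central hyperplane arrangement $\mathcal{A}$ is a finite set of linear hyperplanes in $\mathbb{R}^n$ (each containing the origin). The arrangement determines a complete fan of cones, the faces of the arrangement; its maximal cones are the chambers (the closures of the connected components of the complement of the union of the hyperplanes). For chambers $c,c'$, the separation set $S(c,c')$ is the set of hyperplanes in $\mathcal{A}$ separating $c$ and $c'$. Given a chamber $c_0$ (the fundamental chamber), the poset of chambers $\mathcal{P}(\mathcal{A},c_0)$ is the set of all chambers, ordered by $c\le c'$ if $S(c_0,c)\subseteq S(c_0,c')$. If $X$ is an intersection of hyperplanes of $\mathcal{A}$, a chamber $c$ is incident to $X$ if $X$ is the linear span of a face of $c$, i.e. $c\cap X$ (with $c$ taken closed) has dimension $\dim X$. The upper walls $U(c)$ of a chamber $c$ are the hyperplanes $H\in\mathcal{A}$ incident to $c$ with $H\notin S(c_0,c)$. The arrangement $\mathcal{A}$ with fundamental chamber $c_0$ is bineighborly if for every chamber $c$ and all $H,H'\in U(c)$, the chamber $c$ is incident to $H\cap H'$. For $x\le y$ in a finite lattice $L$, an atom of the interval $[x,y]=\{z: x\le z\le y\}$ is an element $z$ covering $x$ with $z\le y$. A finite lattice $L$ is crosscut-simplicial if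 for every interval $[x,y]$ and every proper subset $B$ of the set of atoms of $[x,y]$, the join of $B$ computed in $[x,y]$ (so the empty join is $x$) is not equal to $y$. A lattice $L$ is meet-semidistributive if for all $x,y,z\in L$, $x\wedge z=y\wedge z$ implies $(x\vee y)\wedge z=x\wedge z$; it is join-semidistributive if it satisfies the dual condition ($x\vee z=y\vee z$ implies $(x\wedge y)\vee z=x\vee z$); it is semidistributive if it is both. *)

(* Defs.v *)
From HB Require Import structures.
From mathcomp Require Import all_boot all_order all_algebra.
From mathcomp Require Import all_classical all_reals all_analysis.
Set Implicit Arguments.
Unset Strict Implicit.
Unset Printing Implicit Defensive.
Import Order.TTheory GRing.Theory Num.Theory.
Import numFieldNormedType.Exports.
Local Open Scope classical_set_scope.
Local Open Scope ring_scope.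

Section FiniteLattices.
Variables (d : Order.disp_t) (L : finLatticeType d).
Implicit Types x y z : L.

Definition covers x y : bool :=
  (x < y)%O && [forall z : L, ~~ ((x < z)%O && (z < y)%O)].

Definition interval_atoms x y : {set L} :=
  [set z : L | covers x z && (z <= y)%O]%SET.

(* For B a set of atoms of [x, y], the join of B computed in [x, y] is the
   join in L of x and the elements of B. *)
Definition crosscut_simplicial : Prop :=
  forall x y, (x <= y)%O ->
  forall B : {set L}, B \proper interval_atoms x y ->
    \big[Order.join/x]_(b in B) b <> y.

Definition meet_semidistributive : Prop :=
  forall x y z, Order.meet x z = Order.meet y z ->
    Order.meet (Order.join x y) z = Order.meet x z.

Definition join_semidistributive : Prop :=
  forall x y z, Order.join x z = Order.join y z ->
    Order.join (Order.meet x y) z = Order.join x z.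

Definition semidistributive : Prop :=
  meet_semidistributive /\ join_semidistributive.

End FiniteLattices.

Section Arrangements.
Variables (R : realType) (n : nat).
Local Notation V := 'rV[R]_n.
Implicit Types (A : set {vspace V}) (H X : {vspace V}) (c : set V).

Definition arrangement A : Prop :=
  finite_set A /\ forall H, A H -> (\dim H).+1 = n.

Definition arrangement_complement A : set V :=
  ~` (\bigcup_(H in A) [set v : V | v \in H]).

Definition chambers A : set (set V) :=
  [set closure (connected_component (arrangement_complement A) v)
     | v in arrangement_complement A].

(* The two sets lie in opposite closed half-spaces bounded by H; for chambers,
   which have nonempty interior, this is strict separation of the interiors. *)
Definition separates H c c' : Prop :=
  exists f : 'Hom(V, R^o),
    [/\ lker f = H, forall v, c v -> 0 <= f v & forall v, c' v -> f v <= 0].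

Definition separation_set A c c' : set {vspace V} :=
  [set H | A H /\ separates H c c'].

Definition chamber_le A c0 c c' : Prop :=
  separation_set A c0 c `<=` separation_set A c0 c'.

(* The poset of chambers P(A, c0) is order isomorphic to L. Finiteness of L
   costs nothing, since a finite arrangement has finitely many chambers. *)
Definition chamber_poset_iso A c0 (d : Order.disp_t) (L : finLatticeType d) :
    Prop :=
  exists f : L -> set V,
    set_bij [set: L] (chambers A) f /\
    forall a b : L, (a <= b)%O <-> chamber_le A c0 (f a) (f b).

Definition is_linear_span (S : set V) X : Prop :=
  (forall v, S v -> v \in X) /\
  forall W : {vspace V}, (forall v, S v -> v \in W) -> (X <= W)%VS.

Definition has_dimension (S : set V) (k : nat) : Prop :=
  exists2 X, is_linear_span S X & \dim X = k.

Definition incident c X : Prop :=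
  has_dimension (c `&` [set v : V | v \in X]) (\dim X).

Definition upper_walls A c0 c : set {vspace V} :=
  [set H | [/\ A H, incident c H & ~ separation_set A c0 c H]].

Definition bineighborly A c0 : Prop :=
  forall c, chambers A c ->
  forall H H', upper_walls A c0 c H -> upper_walls A c0 c H' ->
    incident c (H :&: H')%VS.

End Arrangements.

Arguments crosscut_simplicial {d} L.
Arguments meet_semidistributive {d} L.
Arguments join_semidistributive {d} L.
Arguments semidistributive {d} L.

(* Main.v *)
Require Import Defs.
From HB Require Import structures.
From mathcomp Require Import all_boot all_order all_algebra.
From mathcomp Require Import all_classical all_reals all_analysis.
From mathcomp Require Import ring lra.

(** Orient the hyperplanes by linear forms that are positive on the fundamental
    chamber.  A chamber is then the set S of the forms that are negative on it
    (its separation set), the poset of chambers is a family of sets ordered by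
    inclusion, and T covers S exactly when T adds to S one upper wall of S.

    Suppose that the arrangement is bineighborly, and let h and k be upper
    walls of S.  Near a generic point of the face where they meet, the chamber
    opposite to S has separation set S :|: X, with X the set of hyperplanes
    through this face (cells_polygon).  Every form of X is a nonnegative
    combination of the forms of h and k (cone_of_upper_facets).  So any chamber
    beyond h and k is beyond all of X, which makes S :|: X the join of h |: S
    and k |: S; and any chamber beyond some element of X is beyond h or k.  The
    latter gives meet-semidistributivity for these two covers: if both have a
    given meet with z and if the join had a larger one, a chain of chambers up
    to it would enter X by some step, necessarily h or k, hence below one of
    the two covers (polygon_lub).  An induction from bottom to top extends
    joins and semidistributivity from pairs of covers of an element to all
    pairs (lub_meet_below), and the antipodal map supplies the dual statements
    (polygonal_family_lattice).

    In a meet-semidistributive lattice the elements that meet an atom a of [x,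
    y] in x are closed under joins; they include all the other atoms, and not
    y.  So the lattice is crosscut-simplicial
    (crosscut_of_meet_semidistributive).

    Finally suppose that the poset is a crosscut-simplicial lattice, and let a
    and b be the chambers across two upper walls h and k of c.  They are the
    only atoms of the interval from c to their join, so h and k are the only
    facets of c that separate c from the join.  A positive combination of a
    point of the join and of points of the two facets then lies on both walls
    and strictly inside all the other facets of c, hence on a face of c of
    codimension two (incident_of_upper_facets).  That facets suffice to cut out
    c, and that one can climb from any chamber to any larger one through walls,
    both follow from moving along a generic segment (violated_facet). *)

Set Implicit Arguments.
Unset Strict Implicit.
Unset Printing Implicit Defensive.
Import Order.TTheory GRing.Theory Num.Theory.
Import numFieldNormedType.Exports.
Local Open Scope ring_scope.

(** * Finite lattices *)
Lemma finLattice_of_rel (T : finType) (le : rel T) (meet join : T -> T -> T) :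
    reflexive le -> antisymmetric le -> transitive le ->
    (forall x y z, le x (meet y z) = le x y && le x z) ->
    (forall x y z, le (join x y) z = le x z && le y z) ->
  exists (d : Order.disp_t) (L : finLatticeType d) (e : L -> T),
    bijective e /\ forall a b : L, (a <= b)%O = le (e a) (e b).
Proof.
move=> lexx le_anti le_trans meetP joinP.
pose d : Order.disp_t := Order.Disp tt tt.
pose porder_mix := Order.Le_isPOrder.Build d T lexx le_anti le_trans.
pose P : finPOrderType d := HB.pack T porder_mix.
pose lattice_mix := @Order.POrder_MeetJoin_isLattice.Build d P meet join
  meetP joinP.
pose L : finLatticeType d := HB.pack P lattice_mix.
by exists d, L, id; split=> //; exists id.
Qed.

(** If the join of B were y, then meeting it with an atom a outside B would
    give a.  But distinct atoms meet in x, and meet-semidistributivity says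
    that the elements meeting a in x are closed under joins, so the meet is x. *)
Lemma crosscut_of_meet_semidistributive (d : Order.disp_t)
    (L : finLatticeType d) :
  meet_semidistributive L -> crosscut_simplicial L.
Proof.
move=> msd x y _ B /fintype.properP[/fintype.subsetP subB [a]].
rewrite inE => /andP[/andP[ltxa /forallP nobetween] leay] aB joinB.
suff /esym : Order.meet (\big[Order.join/x]_(b in B) b) a = x.
  rewrite joinB; move/meet_idPl: leay; rewrite meetC => -> eq_xa.
  by rewrite eq_xa ltxx in ltxa.
apply: (big_ind (fun t => Order.meet t a = x)) => [|s t sa ta|b bB].
- exact/meet_idPl/ltW.
- by rewrite msd ?sa ?ta.
- have /subB := bB; rewrite inE => /andP[/andP[ltxb _] _].
  have lexm : (x <= Order.meet b a)%O by rewrite lexI !ltW.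
  have := nobetween (Order.meet b a); rewrite negb_and => /orP[|].
    by rewrite lt_neqAle lexm andbT negbK => /eqP.
  rewrite lt_neqAle leIr andbT negbK => /eqP mba.
  have leab : (a <= b)%O by rewrite -mba leIl.
  have /subB := bB; rewrite inE => /andP[/andP[_ /forallP/(_ a)]].
  rewrite ltxa /= lt_neqAle leab andbT negbK => /eqP eqab.
  by rewrite eqab bB in aB.
Qed.

(** The initial value x need not be neutral for the join, so the term a is not
    split off the iteration: the bound is propagated along an enumeration. *)
Lemma le_bigjoin (d : Order.disp_t) (L : finLatticeType d) (x a : L)
    (B : {set L}) :
  a \in B -> (a <= \big[Order.join/x]_(b in B) b)%O.
Proof.
rewrite -mem_enum -big_enum; elim: (enum B) => //= b s IH.
rewrite big_cons inE => /predU1P[->|/IH les]; first exact: leUl.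
exact: le_trans les (leUr _ _).
Qed.

(** * Families of sets with polygons *)
Section PolygonalFamily.
Variables (I : finType) (F : {set {set I}}).
Implicit Types (S T X u v w x y z : {set I}) (h k : I).

(* F abstracts the family of separation sets of the chambers.  F_step says that
   one can walk upwards to any larger chamber crossing one hyperplane at a
   time.  F_polygon describes the chambers around the codimension-two face at
   which two upper walls h and k of S meet: S :|: X is the chamber opposite to
   S, and each form vanishing on that face is a nonzero combination of the
   forms of h and k with nonnegative coefficients, whence the two conditions
   relating X to any other T. *)
Hypothesis F0 : finset.set0 \in F.
Hypothesis FC : forall S, S \in F -> finset.setC S \in F.
Hypothesis F_step : forall S T, S \in F -> T \in F -> S \proper T ->
  exists h, [/\ h \in T, h \notin S & h |: S \in F]%SET.
Hypothesis F_polygon : forall S h k, S \in F ->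
    h \notin S -> k \notin S -> h != k ->
    (h |: S)%SET \in F -> (k |: S)%SET \in F ->
  exists X, [/\ (S :|: X)%SET \in F, h \in X, k \in X,
    forall T, T \in F -> h \in T -> k \in T -> X \subset T &
    forall T, T \in F -> h \notin T -> k \notin T -> [disjoint T & X]].

Definition is_lub x y (j : {set I}) := [/\ j \in F, x \subset j, y \subset j &
  forall e, e \in F -> x \subset e -> y \subset e -> j \subset e].

(** Locates the step at which a saturated chain from the empty set to v first
    acquires an element of X: v' is a largest member of F below v that avoids
    X. *)
Lemma first_entry v X : v \in F -> ~~ [disjoint v & X] ->
  exists v' h, [/\ [disjoint v' & X], h \in X,
    (h |: v')%SET \in F & (h |: v')%SET \subset v].
Proof.
move=> vF vX.
pose P t := [&& t \in F, t \subset v & [disjoint t & X]].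
have P0 : P finset.set0.
  by rewrite /P F0 finset.sub0set -finset.setI_eq0 finset.set0I eqxx.
have [t /and3P[tF tv tX] t_max] := @arg_maxnP _ _ P (fun t => #|t|) P0.
have ltv : t \proper v.
  by rewrite finset.properEneq tv andbT; apply: contraNneq vX => <-.
have [h [hv ht htF]] := F_step tF vF ltv.
have sub : (h |: t)%SET \subset v.
  by rewrite finset.subUset finset.sub1set hv tv.
exists t, h; split => //; apply/negPn/negP => hX.
have /t_max : P (h |: t)%SET.
  rewrite /P htF sub /= -finset.setI_eq0 finset.setIUl finset.setU_eq0.
  by rewrite !finset.setI_eq0 tX andbT finset.disjoints1.
by rewrite /= finset.cardsU1 ht add1n ltnn.
Qed.

(** Says that the meet of z and t lies below u, without presupposing that meets
    exist; when u is below z and t, it says that this meet is u. *)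
Definition meet_below u z (t : {set I}) :=
  forall v, v \in F -> v \subset t -> v \subset z -> v \subset u.

Lemma meet_below_sub u z (s t : {set I}) :
  s \subset t -> meet_below u z t -> meet_below u z s.
Proof.
by move=> st tQ v vF vs; apply: tQ => //; apply: fintype.subset_trans st.
Qed.

(** The local case of both existence of joins and meet-semidistributivity.  The
    polygon provides the join w :|: X.  If v below it and below z meets X, then
    a chain from the empty set to v enters X by a step i; the conditions on X
    force i to be h or k.  So the set reached by this step lies below h |: w or
    k |: w and below z, hence below u and below w, which is absurd. *)
Lemma polygon_lub u z w h k : w \in F -> u \subset w ->
    h \notin w -> k \notin w -> h != k ->
    (h |: w)%SET \in F -> (k |: w)%SET \in F ->
    meet_below u z (h |: w)%SET -> meet_below u z (k |: w)%SET ->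
  exists2 j, is_lub (h |: w)%SET (k |: w)%SET j & meet_below u z j.
Proof.
move=> wF uw hw kw hk hF kF Qh Qk.
have [X [XF hX kX X_sub X_disj]] := F_polygon wF hw kw hk hF kF.
exists (w :|: X)%SET.
  split=> //; try by rewrite finset.setUC finset.setUS // finset.sub1set.
  move=> e eF; rewrite !finset.subUset !finset.sub1set.
  by move=> /andP[he ->] /andP[ke _] /=; apply: X_sub.
move=> v vF vwX vz; have [vX|vX] := boolP [disjoint v & X].
  apply: Qh => //; apply: fintype.subset_trans (finset.subsetUr _ _).
  apply/fintype.subsetP => i iv; have /fintype.subsetP/(_ i iv) := vwX.
  by rewrite finset.inE (disjointFr vX) ?orbF.
have [v' [i [v'X iX iF iv]]] := first_entry vF vX.
have v'w : v' \subset w.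
  apply/fintype.subsetP => l lv'.
  have /fintype.subsetP/(_ l) : v' \subset (w :|: X)%SET.
    by rewrite (fintype.subset_trans _ vwX) // (fintype.subset_trans _ iv)
      ?finset.subsetUr.
  by rewrite finset.inE (disjointFr v'X) // orbF; apply.
have iz := fintype.subset_trans iv vz.
have absurd l : l \in X -> l \notin w -> meet_below u z (l |: w)%SET ->
    l \in (i |: v')%SET -> v \subset u.
  move=> lX lw Ql; rewrite !finset.inE (disjointFl v'X) // orbF => /eqP li.
  have /fintype.subsetP/(_ l) : (i |: v')%SET \subset u.
    by apply: Ql => //; rewrite li finset.setUS.
  rewrite li finset.setU11 => /(_ isT) /(fintype.subsetP uw).
  by rewrite -li (negbTE lw).
have [hin|hout] := boolP (h \in (i |: v')%SET); first exact: absurd hin.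
have [kin|kout] := boolP (k \in (i |: v')%SET); first exact: absurd kin.
have := X_disj _ iF hout kout.
by rewrite disjoint_sym => /disjointFr/(_ iX); rewrite finset.setU11.
Qed.

(** Local-to-global principle of Bjorner, Edelman and Ziegler: joins exist as
    soon as two covers of a common element have a join.  The induction climbs
    from w to its covers h |: w and k |: w towards x and y, and replaces x and
    y successively by their joins with the join of these covers.  A property
    which is inherited by smaller elements and by the joins of two covers, such
    as meet_below u z, passes through the same induction. *)
Lemma lub_meet_below u z w x y : w \in F -> x \in F -> y \in F ->
    u \subset w -> w \subset x -> w \subset y ->
    meet_below u z x -> meet_below u z y ->
  exists2 j, is_lub x y j & meet_below u z j.
Proof.
have [m] := ubnP #|~: w|%SET.
elim: m w x y => // m IH w x y lt_m wF xF yF uw wx wy Qx Qy.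
have [<-|ne_wx] := eqVneq w x; first by exists y.
have [<-|ne_wy] := eqVneq w y; first by exists x.
have cover t : t \in F -> w \subset t -> w != t -> exists h,
    [/\ h \notin w, (h |: w)%SET \in F, (h |: w)%SET \subset t &
     #|~: (h |: w)|%SET < m]%N.
  move=> tF wt ne_wt.
  have [|h [ht hw hF]] := F_step wF tF; first by rewrite finset.properEneq ne_wt.
  exists h; split=> //; first by rewrite finset.subUset finset.sub1set ht.
  rewrite -ltnS (leq_trans _ lt_m) // ltnS; apply: proper_card.
  by rewrite finset.properC finset.properUr // finset.sub1set.
have [h [hw hF hx h_lt]] := cover x xF wx ne_wx.
have [k [kw kF ky k_lt]] := cover y yF wy ne_wy.
have uS i : u \subset (i |: w)%SET.
  exact: fintype.subset_trans uw (finset.subsetUr _ _).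
have [eq_hk|ne_hk] := eqVneq h k.
  by apply: (IH (h |: w)%SET) => //; rewrite eq_hk.
have [j [jF hj kj j_min] Qj] := polygon_lub wF uw hw kw ne_hk hF kF
  (meet_below_sub hx Qx) (meet_below_sub ky Qy).
have [j1 [j1F xj1 jj1 j1_min] Qj1] :=
  IH _ _ _ h_lt hF xF jF (uS h) hx hj Qx Qj.
have [j2 [j2F j1j2 yj2 j2_min] Qj2] :=
  IH _ _ _ k_lt kF j1F yF (uS k) (fintype.subset_trans kj jj1) ky Qj1 Qy.
exists j2 => //; split=> //; first exact: fintype.subset_trans j1j2.
move=> e eF xe ye; apply: j2_min => //; apply: j1_min => //.
by apply: j_min => //; [apply: fintype.subset_trans xe|
                        apply: fintype.subset_trans ye].
Qed.

(** Joins come from the previous lemma with u and z empty, when the property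
    carried along is trivial; semidistributivity comes from u the common meet.
    Complementation is an order-reversing involution of F: it gives the meets
    and turns meet-semidistributivity into join-semidistributivity. *)
Theorem polygonal_family_lattice :
  exists (d : Order.disp_t) (L : finLatticeType d) (g : L -> {set I}),
    [/\ injective g, forall S, S \in F <-> exists a, g a = S,
        forall a b, (a <= b)%O = (g a \subset g b) & semidistributive L].
Proof.
pose T := {S : {set I} | S \in F}.
have joinE (x y : T) : exists j : T, is_lub (val x) (val y) (val j).
  have triv t : meet_below finset.set0 finset.set0 t by [].
  have [j [jF *]] := lub_meet_below F0 (valP x) (valP y) (finset.sub0set _)
    (finset.sub0set _) (finset.sub0set _) (triv _) (triv _).
  by exists (Sub j jF); split.
pose join (x y : T) := projT1 (cid (joinE x y)).
have joinP (x y : T) : is_lub (val x) (val y) (val (join x y)).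
  by rewrite /join; case: cid.
pose compl (x : T) : T := Sub (~: val x)%SET (FC (valP x)).
have complK : involutive compl.
  by move=> x; apply: val_inj; rewrite /= finset.setCK.
pose le (x y : T) := val x \subset val y.
have le_compl (x y : T) : le (compl x) (compl y) = le y x.
  by rewrite /le /= finset.setCS.
have join_le (x y z : T) : le (join x y) z = le x z && le y z.
  have [_ xj yj j_min] := joinP x y; apply/idP/andP.
    by move=> jz; split; apply: fintype.subset_trans jz.
  by move=> [xz yz]; apply: j_min => //; apply: valP.
pose meet (x y : T) := compl (join (compl x) (compl y)).
have le_meet (x y z : T) : le x (meet y z) = le x y && le x z.
  by rewrite -[x in LHS]complK le_compl join_le -{1}[y]complK -{1}[z]complK
    !le_compl !complK.
have le_anti : antisymmetric le.
  by move=> x y xy; apply: val_inj; apply/eqP; rewrite finset.eqEsubset.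
have le_refl : reflexive le by move=> x; apply: fintype.subxx.
have le_trans : transitive le by move=> y x z; apply: fintype.subset_trans.
have [d [L [e [e_bij eE]]]] :=
  finLattice_of_rel le_refl le_anti le_trans le_meet join_le.
have [e' eK e'K] := e_bij.
have joinL a b : e (Order.join a b) = join (e a) (e b).
  apply: le_anti; rewrite join_le -!eE leUl leUr andbT.
  by rewrite -[join _ _]e'K -eE leUx !eE e'K -join_le /le fintype.subxx.
have meetL a b : e (Order.meet a b) = meet (e a) (e b).
  apply: le_anti; rewrite le_meet -!eE leIl leIr /=.
  by rewrite -[meet _ _]e'K -eE lexI !eE e'K -le_meet /le fintype.subxx.
have msd (x y z : T) : meet x z = meet y z -> meet (join x y) z = meet x z.
  move=> xyz; have [[lexx lexz] [leyx leyz]] :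
      (le (meet x z) x /\ le (meet x z) z) /\
      (le (meet x z) y /\ le (meet x z) z).
    by split; apply/andP; rewrite -le_meet ?xyz /le fintype.subxx.
  have below (t : T) : meet t z = meet x z ->
      meet_below (val (meet x z)) (val z) (val t).
    move=> tz v vF vt vz; rewrite -tz.
    by have := le_meet (Sub v vF) t z; rewrite /le /= vt vz => ->.
  have [j [jF xj yj j_min] Qj] := lub_meet_below (valP (meet x z)) (valP x)
    (valP y) (fintype.subxx _) lexx leyx (below x erefl) (below y (esym xyz)).
  have [_ xj' yj' j'_min] := joinP x y.
  have /andP[mj mz] : le (meet (join x y) z) (join x y) &&
                      le (meet (join x y) z) z.
    by rewrite -le_meet /le fintype.subxx.
  have /andP[xj1 _] : le x (join x y) && le y (join x y).
    by rewrite -join_le /le fintype.subxx.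
  apply: le_anti; apply/andP; split.
    apply: Qj (valP _) _ mz; apply: fintype.subset_trans mj _.
    by apply: j'_min.
  by rewrite le_meet lexz andbT; apply: fintype.subset_trans xj1.
exists d, L, (fun a => val (e a)); split.
- exact: inj_comp val_inj (bij_inj e_bij).
- move=> S; split=> [SF|[a <-]]; last exact: valP.
  by exists (e' (Sub S SF)); rewrite e'K.
- exact: eE.
split=> x y z /(congr1 e).
  by rewrite !meetL => /msd H; apply: (bij_inj e_bij); rewrite !(meetL, joinL).
rewrite !joinL => xyz; apply: (bij_inj e_bij); rewrite !(joinL, meetL).
have joinE' (s t : T) : join s t = compl (meet (compl s) (compl t)).
  by rewrite /meet !complK.
have compl_meet (s t : T) : compl (meet s t) = join (compl s) (compl t).
  by rewrite /meet complK.
rewrite (joinE' (meet _ _)) (joinE' (e x)) (compl_meet (e x));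
  apply: (congr1 compl).
by apply: msd; apply: (can_inj complK); rewrite -!joinE'.
Qed.

End PolygonalFamily.

Local Open Scope classical_set_scope.

(** * Small and generic perturbations *)
Section SmallPerturbations.
Variable R : realType.

Lemma small_perturbation (J : eqType) (s : seq J) (a b : J -> R) :
    (forall j, j \in s -> 0 < a j) ->
  exists2 e, 0 < e & forall j, j \in s -> 0 < a j + e * b j.
Proof.
(* asking the same of every smaller e lets the induction take a minimum *)
move=> a_gt0; suff [e e0 He] : exists2 e, 0 < e & forall e', 0 < e' <= e ->
    forall j, j \in s -> 0 < a j + e' * b j.
  by exists e => //; apply: He; rewrite e0 lexx.
elim: s a_gt0 => [|j s IH] a_gt0; first by exists 1.
have [|e e0 He] := IH; first by move=> i si; apply: a_gt0; rewrite inE si orbT.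
have aj := a_gt0 j (mem_head _ _).
have b1 : 0 < 1 + `|b j| by rewrite ltr_wpDr.
exists (Num.min e (a j / (1 + `|b j|))).
  by rewrite lt_min e0 divr_gt0.
move=> e' /andP[e'0]; rewrite le_min ler_pdivlMr // => /andP[e'e e'a] i.
rewrite inE => /orP[/eqP ->|]; last by apply: He; rewrite e'0.
have /(ler_wpM2l (ltW e'0)) : - b j <= `|b j| by rewrite -normrN ler_norm.
lra.
Qed.

Variable V : lmodType R.

Definition is_form (l : V -> R) :=
  forall x y (e : R), l (x + e *: y) = l x + e * l y.

(** The forms g j are dealt with one at a time: a small move in a direction in
    which g j does not vanish makes it nonzero, and preserves the finitely many
    strict conditions obtained so far. *)
Lemma generic_point (I : finType) (J : eqType) (l : I -> V -> R)
    (s : seq J) (g : J -> V -> R) v :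
    (forall i, is_form (l i)) -> (forall j, is_form (g j)) ->
    (forall j, j \in s -> exists u, g j u != 0) ->
    (forall i, 0 < l i v) ->
  exists2 v', forall i, 0 < l i v' & forall j, j \in s -> g j v' != 0.
Proof.
move=> l_lin g_lin g_neq0 lv.
elim: s g_neq0 => [|j s IH] g_neq0; first by exists v.
have [|v' lv' gv'] := IH.
  by move=> i si; apply: g_neq0; rewrite inE si orbT.
have [gj0|gj] := eqVneq (g j v') 0; last first.
  by exists v' => // i; rewrite inE => /orP[/eqP ->|/gv'].
have [u gju] := g_neq0 j (mem_head _ _).
pose idx : seq (I + J) := map inl (enum I) ++ map inr s.
have [|e e0 He] := @small_perturbation _ idx
  (fun t => match t with inl i => l i v' | inr k => `|g k v'| end)
  (fun t => match t with inl i => l i u | inr k => - `|g k u| end).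
  move=> t; rewrite mem_cat => /orP[] /mapP[i si ->] //.
  by rewrite normr_gt0 gv'.
exists (v' + e *: u) => [i|k].
  rewrite l_lin; apply: (He (inl i)).
  by rewrite mem_cat map_f ?mem_enum.
rewrite inE g_lin => /orP[/eqP ->|sk].
  by rewrite gj0 add0r mulf_neq0 ?(lt0r_neq0 e0).
have : 0 < `|g k v'| + e * - `|g k u|.
  by apply: (He (inr k)); rewrite mem_cat orbC map_f.
rewrite mulrN subr_gt0; apply: contraTneq => /eqP; rewrite addr_eq0 => /eqP ->.
by rewrite normrN normrM gtr0_norm // ltxx.
Qed.

End SmallPerturbations.

(** * Cells of an arrangement of oriented hyperplanes *)
Section SignedForms.
Variables (R : realType) (n : nat) (I : finType).
Local Notation V := 'rV[R]_n.
Variables (f : I -> 'Hom(V, R^o)) (v0 : V).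
(* The forms are oriented so as to be positive at a point v0 of the fundamental
   chamber; the separation set of a chamber is then the set of indices of the
   forms that are negative on it. *)
Hypothesis f_v0 : forall i, 0 < (f i v0 : R).
Hypothesis f_indep : forall i j, i != j -> exists2 v, f i v = 0 & f j v != 0.
Implicit Types (S T : {set I}) (i j h k : I) (v w p x : V) (X : {vspace V}).

(** The form f i with its sign changed when i is in S, so that all the signed
    forms are positive on the chamber with separation set S. *)
Definition sgf S i v : R := (-1) ^+ (i \in S) * f i v.

Definition open_cell S : set V := [set v | forall i, 0 < sgf S i v].
Definition closed_cell S : set V := [set v | forall i, 0 <= sgf S i v].
(** The separation sets of the chambers. *)
Definition cells : {set {set I}} := [set S | `[< open_cell S !=set0 >]]%SET.

Lemma cellsP S : reflect (exists v, open_cell S v) (S \in cells).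
Proof. by rewrite inE; apply: (iffP (asboolP _)). Qed.

Lemma hom_form (g : 'Hom(V, R^o)) : is_form (g : V -> R).
Proof. by move=> x y e; rewrite linearD linearZ. Qed.

Lemma sgf_form S i : is_form (sgf S i).
Proof. by move=> x y e; rewrite /sgf hom_form; ring. Qed.

Lemma sgf0 S i : sgf S i 0 = 0. Proof. by rewrite /sgf linear0 mulr0. Qed.

Lemma sgfZ S i (e : R) v : sgf S i (e *: v) = e * sgf S i v.
Proof. by rewrite -[e *: v]add0r sgf_form sgf0 add0r. Qed.

Lemma sgfD S i v w : sgf S i (v + w) = sgf S i v + sgf S i w.
Proof. by rewrite -[w]scale1r sgf_form mul1r scale1r. Qed.

Lemma sgf_sum S i (J : finType) (p : J -> V) :
  sgf S i (\sum_j p j) = \sum_j sgf S i (p j).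
Proof. by rewrite /sgf linear_sum mulr_sumr. Qed.

Lemma sgf_in S i v : i \in S -> sgf S i v = - f i v.
Proof. by rewrite /sgf => ->; rewrite mulN1r. Qed.

Lemma sgf_notin S i v : i \notin S -> sgf S i v = f i v.
Proof. by rewrite /sgf => /negbTE ->; rewrite mul1r. Qed.

Lemma sgf_eq0 S i v : (sgf S i v == 0) = (f i v == 0).
Proof. by rewrite /sgf mulf_eq0 signr_eq0. Qed.

Lemma sgf_agree S T i v : (i \in S) = (i \in T) -> sgf S i v = sgf T i v.
Proof. by rewrite /sgf => ->. Qed.

Lemma sgf_oppose S T i v : (i \in S) != (i \in T) -> sgf S i v = - sgf T i v.
Proof.
by rewrite /sgf; case: (i \in S); case: (i \in T) => // _;
  rewrite mulN1r mul1r ?opprK.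
Qed.

Lemma mem_sgf S i v : 0 < sgf S i v -> (i \in S) = ((f i v : R) < 0).
Proof.
have [iS|iS] := boolP (i \in S); first by rewrite sgf_in // oppr_gt0.
by rewrite sgf_notin // => /ltW; rewrite leNgt => /negbTE.
Qed.

Lemma open_cell_closed S v : open_cell S v -> closed_cell S v.
Proof. by move=> Sv i; apply: ltW. Qed.

Lemma cells0 : finset.set0 \in cells.
Proof. by apply/cellsP; exists v0 => i; rewrite sgf_notin ?inE. Qed.

Lemma cellsC S : S \in cells -> (~: S)%SET \in cells.
Proof.
move=> /cellsP[v Sv]; apply/cellsP; exists (- v) => i.
rewrite -scaleN1r sgfZ (@sgf_oppose _ S) ?mulN1r ?opprK //.
by rewrite finset.inE; case: (i \in S).
Qed.

(** A point in the relative interior of a facet, lying on the k-th hyperplane,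
    of the chamber with separation set S. *)
Definition facet_point S k p :=
  sgf S k p = 0 /\ forall i, i != k -> 0 < sgf S i p.

(** A closed chamber is cut out by its facets alone.  Travel on the segment
    from v to w: the first hyperplane crossed carries a facet, provided it is
    crossed alone.  Moving v inside its chamber makes all crossing times
    distinct: two hyperplanes are crossed simultaneously only if v lies in the
    kernel of the form g, which is nonzero as the two are distinct. *)
Lemma violated_facet S v w i0 : open_cell S v -> sgf S i0 w < 0 ->
  exists k p, sgf S k w < 0 /\ facet_point S k p.
Proof.
move=> Sv wi0.
pose neg i := sgf S i w < 0.
pose s := [seq q : I * I <- enum {: I * I} | [&& q.1 != q.2, neg q.1 & neg q.2]].
pose g (q : I * I) x := sgf S q.1 x * sgf S q.2 w - sgf S q.2 x * sgf S q.1 w.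
have [||v' Sv' gv'] := @generic_point R V I _ (sgf S) s g v (sgf_form S) _ _ Sv.
- by move=> q x y e; rewrite /g !sgf_form; ring.
- move=> [i j]; rewrite mem_filter /= => /andP[/and3P[ij wi wj] _].
  have [u fi fj] := f_indep ij; exists u; rewrite /g /=.
  move/eqP: fi; rewrite -(sgf_eq0 S) => /eqP ->; rewrite mul0r sub0r oppr_eq0.
  by rewrite mulf_neq0 ?(lt_eqF wi) ?sgf_eq0.
(* the crossing time of the i-th hyperplane increases with this quotient *)
have [k wk kmin] := @arg_minP _ _ _ i0 neg (fun i => sgf S i v' / - sgf S i w) wi0.
(* the crossing point, up to a positive factor *)
exists k, (sgf S k v' *: w + (- sgf S k w) *: v'); split=> //; split.
  by rewrite sgf_form !sgfZ; ring.
move=> i ik; rewrite sgf_form sgfZ.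
have v'k := Sv' k; have v'i := Sv' i.
have [wi|wi] := ltP (sgf S i w) 0; last first.
  apply: ltr_wpDl; first by rewrite mulr_ge0 // ltW.
  by rewrite mulr_gt0 // oppr_gt0.
rewrite /neg in wk.
have : sgf S k v' / - sgf S k w <= sgf S i v' / - sgf S i w by apply: kmin.
rewrite ler_pdivrMr ?oppr_gt0 // mulrAC ler_pdivlMr ?oppr_gt0 // => le_ki.
have /gv' : (k, i) \in s by rewrite mem_filter /= /neg eq_sym ik wk wi mem_enum.
rewrite /g /= => /eqP ne_ki; rewrite lt_neqAle.
apply/andP; split; last by lra.
by apply/eqP => eq_ki; apply: ne_ki; lra.
Qed.

(** From a point of the facet, a small move away from v changes the side of the
    k-th hyperplane and of no other. *)
Lemma facet_step S k p v : open_cell S v -> facet_point S k p ->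
  (if k \in S then S :\ k else k |: S)%SET \in cells.
Proof.
move=> Sv [pk pS].
have [|e e0 He] := @small_perturbation R I (enum (predC1 k))
  (fun i => sgf S i p) (fun i => - sgf S i v).
  by move=> i; rewrite mem_enum => /pS.
apply/cellsP; exists (p + (- e) *: v) => i; have [->|ik] := eqVneq i k.
  rewrite (@sgf_oppose _ S); last by case: ifP => kS; rewrite !finset.inE eqxx kS.
  by rewrite sgf_form pk add0r mulNr opprK mulr_gt0.
rewrite (@sgf_agree _ S); last first.
  by case: ifP; rewrite !finset.inE (negbTE ik).
by rewrite sgf_form mulNr -mulrN He // mem_enum.
Qed.

Lemma cells_step S T : S \in cells -> T \in cells -> S \proper T ->
  exists h, [/\ h \in T, h \notin S & (h |: S)%SET \in cells].
Proof.
move=> /cellsP[v Sv] /cellsP[w Tw] /fintype.properP[/fintype.subsetP ST [i iT iS]].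
have wi : sgf S i w < 0.
  by rewrite (@sgf_oppose _ T) ?oppr_lt0 // iT (negbTE iS).
have [k [p [wk kp]]] := violated_facet Sv wi.
have kST : (k \in S) != (k \in T).
  by apply: contraTneq wk => /sgf_agree ->; rewrite -leNgt ltW.
have kS : k \notin S.
  by apply: contra kST => kS; rewrite kS ST.
exists k; split=> //; first by move: kST; rewrite (negbTE kS); case: (k \in T).
by have := facet_step Sv kp; rewrite (negbTE kS).
Qed.

(** The converse of the previous step: a segment between two chambers that
    differ only by k meets the k-th hyperplane at a point of the common facet. *)
Lemma upper_facetP S k : S \in cells -> k \notin S ->
  (k |: S)%SET \in cells <-> exists p, facet_point S k p.
Proof.
move=> /cellsP[v Sv] kS; split=> [/cellsP[w kSw]|[p pk]]; last first.
  by have := facet_step Sv pk; rewrite (negbTE kS).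
have wk : sgf S k w < 0.
  by rewrite (@sgf_oppose _ (k |: S)%SET) ?oppr_lt0 // !finset.inE eqxx (negbTE kS).
exists (sgf S k v *: w + (- sgf S k w) *: v); split.
  by rewrite sgf_form sgfZ; ring.
move=> i ik; rewrite sgf_form sgfZ.
have wi : 0 < sgf S i w.
  by rewrite (@sgf_agree _ (k |: S)%SET) // !finset.inE (negbTE ik).
by rewrite addr_gt0 // mulr_gt0 ?oppr_gt0.
Qed.

(** A point p of a closed chamber in X lying on no hyperplane but those through
    X has a neighbourhood in X contained in the chamber, so that the chamber
    meets X in full dimension.  Conversely, if it does, then for each
    hyperplane not containing X some point of the intersection is off it; the
    sum of these points is off all of them at once, since the signed forms are
    nonnegative on the chamber. *)
Lemma incidentP S X : incident (closed_cell S) X <->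
  exists p, [/\ closed_cell S p, p \in X &
    forall i, f i p = 0 -> (X <= lker (f i))%VS].
Proof.
split=> [[Y [subY minY] dimY]|[p [Sp pX p_gen]]].
  have eqXY : Y = X.
    apply/eqP; rewrite eqEdim dimY leqnn andbT; apply: minY.
    by move=> v [].
  have /choice[p Hp] : forall i, exists p, [/\ closed_cell S p, p \in X &
      ~~ (X <= lker (f i))%VS -> f i p != 0].
    move=> i; have [//|Xi] := boolP (X <= lker (f i))%VS.
      by exists 0; split=> //; [move=> j; rewrite sgf0|rewrite mem0v].
    apply/not_existsP => no; case/negP: Xi; rewrite -eqXY; apply: minY => v [Sv vX].
    by apply: contrapT => /negP; rewrite memv_ker => fv; apply: (no v).
  exists (\sum_i p i); split.
  - by move=> i; rewrite sgf_sum sumr_ge0 // => j _; have [] := Hp j.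
  - by rewrite rpred_sum // => i _; have [] := Hp i.
  - move=> i /eqP; rewrite -(sgf_eq0 S) sgf_sum psumr_eq0; last first.
      by move=> j _; have [] := Hp j.
    move=> /allP/(_ i (mem_index_enum _)) /=; rewrite sgf_eq0.
    by apply: contraTT; have [_ _] := Hp i.
exists X => //; split=> [v []//|W subW].
apply/subvP => x xX.
have [|e e0 He] := @small_perturbation R I
  [seq i <- enum I | ~~ (X <= lker (f i))%VS] (sgf S ^~ p) (sgf S ^~ x).
  move=> i; rewrite mem_filter => /andP[Xi _].
  by rewrite lt_neqAle Sp andbT eq_sym sgf_eq0; apply: contra Xi => /eqP/p_gen.
have pW : p \in W by apply: subW.
have : p + e *: x \in W.
  apply: subW; split; last by rewrite /= rpredD ?rpredZ.
  move=> i; rewrite sgf_form; have [Xi|Xi] := boolP (X <= lker (f i))%VS.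
    have /subvP/(_ x xX) := Xi; rewrite memv_ker -(sgf_eq0 S) => /eqP ->.
    by rewrite mulr0 addr0; apply: Sp.
  by apply/ltW/He; rewrite mem_filter Xi mem_enum.
by rewrite rpredDl // rpredZeq gt_eqF.
Qed.

Lemma incident_facetP S k :
  incident (closed_cell S) (lker (f k)) <-> exists p, facet_point S k p.
Proof.
rewrite incidentP; split=> [[p [Sp pk p_gen]]|[p [pk pS]]]; exists p; split.
- by apply/eqP; rewrite sgf_eq0 -memv_ker.
- move=> i ik; rewrite lt_neqAle Sp andbT eq_sym sgf_eq0.
  apply/eqP => /p_gen/subvP ki.
  have [|v vk] := @f_indep k i; first by rewrite eq_sym.
  by rewrite -memv_ker ki // memv_ker vk.
- by move=> i; have [->|/pS/ltW//] := eqVneq i k; rewrite pk.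
- by rewrite memv_ker -(sgf_eq0 S) pk.
- move=> i fi; have [->//|/pS] := eqVneq i k.
  by rewrite lt_neqAle eq_sym sgf_eq0 fi eqxx.
Qed.

Lemma closed_cell_facets S v w : open_cell S v ->
  (forall k p, facet_point S k p -> 0 <= sgf S k w) -> closed_cell S w.
Proof.
move=> Sv w_ge0 i; rewrite leNgt; apply/negP => wi.
have [k [p [wk /w_ge0]]] := violated_facet Sv wi.
by rewrite leNgt wk.
Qed.

(** How the order detects codimension-two faces.  Let T be above S, beyond h
    and k, and such that h and k are the only facets of S separating the two.
    With p and r on these facets and q in T, a suitable positive combination z
    of p, r and q is on both hyperplanes.  The other facets of S do not
    separate S from T, so z is strictly on the positive side of them. *)
Lemma incident_of_upper_facets S T h k : S \in cells -> T \in cells ->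
    S \subset T -> h != k -> h \notin S -> k \notin S ->
    (h |: S)%SET \in cells -> (k |: S)%SET \in cells -> h \in T -> k \in T ->
    (forall g, g \notin S -> (g |: S)%SET \in cells -> g \in T ->
      g \in [set h; k]%SET) ->
  incident (closed_cell S) (lker (f h) :&: lker (f k))%VS.
Proof.
move=> Scell /cellsP[q Tq] /fintype.subsetP ST hk hS kS.
move=> /(upper_facetP Scell hS)[p [ph pS]] /(upper_facetP Scell kS)[r [rk rS]].
move=> hT kT only_hk; have /cellsP[v Sv] := Scell.
have a0 : 0 < sgf S h r by apply: rS.
have b0 : 0 < sgf S k p by apply: pS; rewrite eq_sym.
have oppose g : g \notin S -> g \in T -> sgf S g q < 0.
  by move=> gS gT; rewrite (@sgf_oppose _ T) ?oppr_lt0 // gT (negbTE gS).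
have qh := oppose h hS hT; have qk := oppose k kS kT.
pose z := (- sgf S h q * sgf S k p) *: r + (- sgf S k q * sgf S h r) *: p
          + (sgf S h r * sgf S k p) *: q.
have zh : sgf S h z = 0 by rewrite !sgfD !sgfZ ph; ring.
have zk : sgf S k z = 0 by rewrite !sgfD !sgfZ rk; ring.
have zfacet g p' : g != h -> g != k -> facet_point S g p' -> 0 < sgf S g z.
  move=> gh gk gp'; rewrite !sgfD !sgfZ.
  have qg : 0 < sgf S g q.
    rewrite (@sgf_agree _ T) //.
    have [/ST -> //|gS] := boolP (g \in S).
    apply/esym/negbTE/negP => gT.
    have : g \in [set h; k]%SET.
      by apply: only_hk => //; apply/(upper_facetP Scell gS); exists p'.
    by rewrite !finset.inE (negbTE gh) (negbTE gk).
  have := pS g gh; have := rS g gk => rg pg.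
  by rewrite !addr_gt0 // mulr_gt0 // mulr_gt0 // oppr_gt0.
pose X := (lker (f h) :&: lker (f k))%VS.
(* small moves within X preserve all the facet inequalities at z, and these cut
   out the cell *)
have near_z x : x \in X -> exists2 e, 0 < e & closed_cell S (z + e *: x).
  rewrite memv_cap !memv_ker -!(sgf_eq0 S) => /andP[/eqP xh /eqP xk].
  pose s := [seq g <- enum I | [&& g != h, g != k & 0 < sgf S g z]].
  have [|e e0 He] := @small_perturbation R I s (sgf S ^~ z) (sgf S ^~ x).
    by move=> g; rewrite mem_filter => /andP[/and3P[]].
  exists e => //; apply: (closed_cell_facets Sv) => g p' gp'.
  rewrite sgf_form; have [->|gh] := eqVneq g h; first by rewrite zh xh; lra.
  have [->|gk] := eqVneq g k; first by rewrite zk xk; lra.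
  by apply/ltW/He; rewrite mem_filter gh gk (zfacet _ p') // mem_enum.
apply/incidentP; exists z; split.
- by have [e _] := near_z _ (mem0v X); rewrite scaler0 addr0.
- by rewrite memv_cap !memv_ker -!(sgf_eq0 S) zh zk eqxx.
move=> i /eqP; rewrite -(sgf_eq0 S) => /eqP zi; apply/subvP => x xX.
have x_ge0 y : y \in X -> 0 <= sgf S i y.
  move=> /near_z[e e0 /(_ i)].
  by rewrite sgf_form zi add0r pmulr_rge0.
rewrite memv_ker -(sgf_eq0 S) eq_le x_ge0 // andbT.
have : 0 <= sgf S i (- x) by rewrite x_ge0 // rpredN.
by rewrite -scaleN1r sgfZ mulN1r oppr_ge0.
Qed.

(** The i-th form vanishes on the intersection of h and k, so it is a
    combination of the forms of h and k, and its coefficients are read off at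
    points p and r of the two facets.  Unless i is h or k, they have the same
    sign, as p and r are on the same side of the i-th hyperplane; both negative
    is excluded by the positivity of all forms at v0. *)
Lemma cone_of_upper_facets S h k i : S \in cells -> h != k ->
    h \notin S -> k \notin S ->
    (h |: S)%SET \in cells -> (k |: S)%SET \in cells ->
    (lker (f h) :&: lker (f k) <= lker (f i))%VS ->
  exists a b : R, [/\ 0 <= a, 0 <= b, 0 < a + b &
    forall v, f i v = a * f h v + b * f k v].
Proof.
move=> Scell hk hS kS.
move=> /(upper_facetP Scell hS)[p [ph pS]] /(upper_facetP Scell kS)[r [rk rS]].
move=> /subvP hki.
have rh : 0 < (f h r : R) by rewrite -(sgf_notin _ hS) rS.
have pk : 0 < (f k p : R) by rewrite -(sgf_notin _ kS) pS // eq_sym.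
move: ph rk; rewrite !sgf_notin // => ph rk.
have fiE v : f i v = f i r / f h r * f h v + f i p / f k p * f k v :> R.
  pose x := v + (- (f h v / f h r)) *: r + (- (f k v / f k p)) *: p.
  have /hki : x \in (lker (f h) :&: lker (f k))%VS.
    rewrite memv_cap !memv_ker /x !hom_form ph rk.
    by apply/andP; split; apply/eqP; field; rewrite !lt0r_neq0.
  rewrite memv_ker /x !hom_form => /eqP fx.
  by rewrite -[LHS]subr0 -fx; ring.
exists (f i r / f h r), (f i p / f k p).
have [ih|ih] := eqVneq i h.
  rewrite ih ph mul0r divff ?lt0r_neq0 // addr0; split=> //.
  by move=> v; rewrite mul1r mul0r addr0.
have [ik|ik] := eqVneq i k.
  rewrite ik rk mul0r divff ?lt0r_neq0 // add0r; split=> //.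
  by move=> v; rewrite mul1r mul0r add0r.
have := pS i ih; have := rS i ik.
have [iS|iS] := boolP (i \in S).
  rewrite !(sgf_in _ iS) !oppr_gt0 => ri pi; have := f_v0 i.
  have a0 : f i r / f h r <= 0 by rewrite ler_pdivrMr // mul0r ltW.
  have b0 : f i p / f k p <= 0 by rewrite ler_pdivrMr // mul0r ltW.
  by rewrite fiE; have := f_v0 h; have := f_v0 k; nra.
rewrite !(sgf_notin _ iS) => ri pi; split=> //; rewrite ?divr_ge0 ?ltW //.
by rewrite addr_gt0 // divr_gt0.
Qed.

(** If p is a generic point of the face where the facets h and k meet, then
    moving from p in the direction opposite to v0 leads to the chamber in which
    exactly the hyperplanes through the face have changed sides. *)
Lemma cells_polygon S h k : S \in cells -> h \notin S -> k \notin S -> h != k ->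
    (h |: S)%SET \in cells -> (k |: S)%SET \in cells ->
    incident (closed_cell S) (lker (f h) :&: lker (f k))%VS ->
  exists X : {set I}, [/\ (S :|: X)%SET \in cells, h \in X, k \in X,
    forall T, T \in cells -> h \in T -> k \in T -> X \subset T &
    forall T, T \in cells -> h \notin T -> k \notin T -> [disjoint T & X]%B].
Proof.
move=> Scell hS kS hk hcell kcell /incidentP[p [Sp pX p_gen]].
pose X : {set I} := [set i | lker (f h) :&: lker (f k) <= lker (f i)]%VS%SET.
have Xcone i (iX : i \in X) := cone_of_upper_facets Scell hk hS kS hcell kcell
  (etrans (esym (finset.in_set _ i)) iX).
exists X; split; rewrite ?finset.inE ?capvSl ?capvSr //.
- have [|e e0 He] := @small_perturbation R I [seq i <- enum I | i \notin X]
    (sgf S ^~ p) (fun i => - sgf S i v0).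
    move=> i; rewrite mem_filter => /andP[iX _].
    rewrite lt_neqAle Sp andbT eq_sym sgf_eq0.
    by apply: contra iX => /eqP/p_gen; rewrite finset.inE.
  apply/asboolP; exists (p + (- e) *: v0) => i.
  have [iX|iX] := boolP (i \in X); last first.
    rewrite (@sgf_agree _ S); last by rewrite finset.inE (negbTE iX) orbF.
    by rewrite sgf_form mulNr -mulrN He // mem_filter iX mem_enum.
  rewrite sgf_in; last by rewrite finset.in_setU iX orbT.
  move: iX; rewrite finset.inE => /subvP/(_ _ pX); rewrite memv_ker => /eqP fp.
  by rewrite hom_form fp add0r mulNr opprK mulr_gt0.
- move=> T /cellsP[v Tv] hT kT; apply/fintype.subsetP => i /Xcone[a [b [a0 b0 ab fi]]].
  move: hT kT; rewrite !(mem_sgf (Tv _)) fi => hv kv.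
  have [a_gt0|a_le0] := ltP 0 a; first by nra.
  have b_gt0 : 0 < b by lra.
  by nra.
- move=> T /cellsP[v Tv]; rewrite !(mem_sgf (Tv _)) -!leNgt => hv kv.
  rewrite -finset.setI_eq0; apply/eqP/setP => i; rewrite finset.inE.
  rewrite (mem_sgf (Tv i)) finset.in_set0; apply/negP => /andP[iv].
  by move=> /Xcone[a [b [a0 b0 ab fi]]]; move: iv; rewrite fi; nra.
Qed.

(** * Chambers as closed cells *)
Lemma f_continuous i : continuous (f i : V -> R).
Proof.
have -> : (f i : V -> R) =
    (fun v => \sum_j v ord0 j * (f i (delta_mx ord0 j) : R)).
  apply/funext => v; rewrite {1}(row_sum_delta v) linear_sum.
  by apply: eq_bigr => j _; rewrite linearZ.
apply: continuous_big => [|j _ v]; first exact: add_continuous.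
by have cj := @coord_continuous R 1 n ord0 j v; apply: cvgM cj (cvg_cst _).
Qed.

Lemma sgf_continuous S i : continuous (sgf S i).
Proof. by move=> v; apply: cvgM (cvg_cst _) (@f_continuous i v). Qed.

Lemma segment_continuous v w : continuous (fun t : R => v + t *: w).
Proof. by move=> t; apply: cvgD; [exact: cvg_cst|exact: scalel_continuous]. Qed.

Lemma closure_open_cell S : S \in cells -> closure (open_cell S) = closed_cell S.
Proof.
move=> /cellsP[v Sv]; apply/seteqP; split.
  have closed_S : closed (closed_cell S).
    have -> : closed_cell S = \bigcap_i (sgf S i @^-1` [set r | 0 <= r]).
      by apply/seteqP; split=> [w Sw i _|w Sw i]; apply: Sw.
    apply: closed_bigI => i _; apply: closed_comp; last exact: closed_ge.
    by move=> w _; apply: sgf_continuous.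
  rewrite [X in _ `<=` X](closure_id _).1 //.
  by apply: closureS => w; apply: open_cell_closed.
move=> w Sw U Uw.
have : (fun t : R => w + t *: v) @ 0^'+ --> w.
  apply: cvg_at_right_filter; have := @segment_continuous w v 0.
  by rewrite /continuous_at scale0r addr0.
move=> /(_ U Uw) Ut.
near (0 : R)^'+ => e; exists (w + e *: v); split.
  by move=> i; rewrite sgf_form ltr_wpDl ?Sw // mulr_gt0 ?Sv.
by near: e.
Unshelve. all: by end_near. Qed.

Section Arrangement.

Let A : set {vspace V} := range (fun i => lker (f i)).
Local Notation fundamental := (closed_cell finset.set0).

Lemma arrangement_complementP v :
  arrangement_complement A v <-> exists S, open_cell S v.
Proof.
split=> [compl_v|[S Sv]]; last first.
  move=> [H [i _ <-]]; rewrite /= memv_ker -(sgf_eq0 S).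
  by rewrite gt_eqF.
exists [set i | (f i v : R) < 0]%SET => i.
have fi : (f i v : R) != 0.
  apply/negP => fi; apply: compl_v; exists (lker (f i)); first by exists i.
  by rewrite /= memv_ker.
have [fv|fv] := ltP (f i v : R) 0; first by rewrite sgf_in ?oppr_gt0 ?finset.inE.
by rewrite sgf_notin ?finset.inE -?leNgt // lt_neqAle eq_sym fi.
Qed.

(** Open cells are convex, and no connected subset of the complement can
    contain points at which a form takes opposite signs. *)
Lemma component_open_cell S v : open_cell S v ->
  connected_component (arrangement_complement A) v = open_cell S.
Proof.
move=> Sv; apply/seteqP; split=> w.
  move=> vw i; rewrite ltNge; apply/negP => wi.
  set C := connected_component (arrangement_complement A) v in vw.
  have vC : C v.
    by apply: connected_component_refl; apply/arrangement_complementP; exists S.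
  have : connected (sgf S i @` C).
    apply: connected_continuous_connected; first exact: component_connected.
    by apply: continuous_subspaceT => x; apply: sgf_continuous.
  move=> /connected_intervalP itv.
  have [||//|u uC /eqP] := itv (sgf S i w) (sgf S i v) _ _ 0.
  - by exists w.
  - by exists v.
  - by rewrite wi ltW.
  have /connected_component_sub/arrangement_complementP[T Tu] := uC.
  by rewrite sgf_eq0 -(sgf_eq0 T) gt_eqF.
move=> Sw.
pose B := (fun t : R => v + t *: (w - v)) @` `[0, 1]%classic.
have BS : B `<=` open_cell S.
  move=> _ [t /= + <-] i; rewrite in_itv /= => /andP[t0 t1].
  rewrite sgf_form sgfD -scaleN1r sgfZ.
  by have := Sv i; have := Sw i; nra.
apply: (@connected_component_max _ _ B).
- by exists 0; rewrite /= ?in_itv /= ?lexx ?ler01 // scale0r addr0.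
- by move=> u /BS Su; apply/arrangement_complementP; exists S.
- apply: connected_continuous_connected; first exact: segment_connected.
  by apply: continuous_subspaceT => t; apply: segment_continuous.
- by exists 1; rewrite /= ?in_itv /= ?lexx ?ler01 // scale1r addrC subrK.
Qed.

Lemma chambersP c :
  chambers A c <-> exists2 S, S \in cells & c = closed_cell S.
Proof.
split=> [[v /arrangement_complementP[S Sv] <-]|[S Scell ->]].
  have Scell : S \in cells by apply/cellsP; exists v.
  by exists S; rewrite // (component_open_cell Sv) closure_open_cell.
have /cellsP[v Sv] := Scell; exists v; last first.
  by rewrite (component_open_cell Sv) closure_open_cell.
by apply/arrangement_complementP; exists S.
Qed.

Lemma separatesP S T i : S \in cells -> T \in cells ->
  separates (lker (f i)) (closed_cell S) (closed_cell T) <->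
  (i \in S) != (i \in T).
Proof.
move=> /cellsP[v Sv] /cellsP[w Tw]; split=> [[g [kerg gS gT]]|ST].
  (* g is a multiple of f i, hence of the form that is positive on S *)
  have gv : 0 < (g v : R).
    rewrite lt_neqAle gS ?andbT; last exact: open_cell_closed.
    by rewrite eq_sym -memv_ker kerg memv_ker -(sgf_eq0 S) gt_eqF.
  have gw : (g w : R) < 0.
    rewrite lt_neqAle gT ?andbT; last exact: open_cell_closed.
    by rewrite -memv_ker kerg memv_ker -(sgf_eq0 T) gt_eqF.
  have : v + (- (g v / g w : R)) *: w \in lker g.
    by rewrite memv_ker hom_form mulNr divfK ?subrr // (lt_eqF gw).
  rewrite kerg memv_ker -(sgf_eq0 S) sgf_form => /eqP.
  move=> eq0; apply/negP => /eqP/(@sgf_agree S T i w) STw.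
  have q0 : 0 < - (g v / g w : R) by rewrite oppr_gt0 pmulr_rlt0 // invr_lt0.
  have : 0 < sgf S i v + - (g v / g w : R) * sgf T i w.
    by rewrite addr_gt0 // mulr_gt0.
  by rewrite -STw eq0 ltxx.
exists ((-1) ^+ (i \in S) *: f i); split.
- by apply/vspaceP => u; rewrite !memv_ker scale_lfunE scaler_eq0 signr_eq0.
- by move=> u /(_ i); rewrite scale_lfunE.
- move=> u /(_ i); rewrite (sgf_oppose u (T := S)) 1?eq_sym // oppr_ge0.
  by rewrite scale_lfunE.
Qed.

Lemma separation_setP S i : S \in cells ->
  separation_set A fundamental (closed_cell S) (lker (f i)) <->
  i \in S.
Proof.
move=> Scell; rewrite /separation_set /=; split=> [[_]|iS].
  by move=> /(separatesP _ cells0 Scell); rewrite finset.inE; case: (i \in S).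
split; first by exists i.
by apply/(separatesP _ cells0 Scell); rewrite finset.inE iS.
Qed.

Lemma chamber_leP S T : S \in cells -> T \in cells ->
  chamber_le A fundamental (closed_cell S) (closed_cell T) <->
  S \subset T.
Proof.
move=> Scell Tcell; split=> [ST|/fintype.subsetP ST].
  apply/fintype.subsetP => i /(separation_setP i Scell)/ST.
  by move=> /(separation_setP i Tcell).
move=> H SH; have [[i _ eH] _] := SH; subst H.
by apply/(separation_setP i Tcell)/ST/(separation_setP i Scell).
Qed.

Lemma closed_cell_inj S T : S \in cells -> T \in cells ->
  closed_cell S = closed_cell T -> S = T.
Proof.
move=> Scell Tcell ST; apply/eqP; rewrite finset.eqEsubset.
by apply/andP; split; apply/(chamber_leP _ _) => //; rewrite ST.
Qed.

Lemma upper_wallsP S i : S \in cells ->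
  upper_walls A fundamental (closed_cell S) (lker (f i)) <->
  i \notin S /\ (i |: S)%SET \in cells.
Proof.
move=> Scell; split=> [[_ inc sep]|[iS iScell]].
  have iS : i \notin S by apply/negP => /(separation_setP i Scell).
  by split=> //; apply/(upper_facetP Scell iS)/incident_facetP.
split; first by exists i.
- exact/incident_facetP/(upper_facetP Scell iS).
- by move=> /(separation_setP i Scell); rewrite (negbTE iS).
Qed.

Lemma bineighborlyP : bineighborly A fundamental <->
  forall S h k, S \in cells -> h \notin S -> k \notin S -> h != k ->
    (h |: S)%SET \in cells -> (k |: S)%SET \in cells ->
    incident (closed_cell S) (lker (f h) :&: lker (f k))%VS.
Proof.
split=> [binA S h k Scell hS kS hk hcell kcell|binA].
  by apply: binA; [apply/chambersP; exists S|exact/upper_wallsP..].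
move=> _ /chambersP[S Scell ->] H K SH SK.
have [[h _ eH] inc _] := SH; have [[k _ eK] _ _] := SK; subst H K.
have [[hS hcell] [kS kcell]] := (iffLR (upper_wallsP h Scell) SH,
                                 iffLR (upper_wallsP k Scell) SK).
have [->|hk] := eqVneq h k; last exact: binA.
by move: SK => [_ +]; rewrite capvv.
Qed.

(** * From the order to the geometry and back *)
(** Forgets the topology: up to isomorphism the poset of chambers is the family
    of separation sets, ordered by inclusion. *)
Lemma chamber_poset_isoP (d : Order.disp_t) (L : finLatticeType d) :
  chamber_poset_iso A fundamental L <->
  exists g : L -> {set I}, [/\ injective g,
    forall S, S \in cells <-> exists a, g a = S &
    forall a b, (a <= b)%O = (g a \subset g b)].
Proof.
split=> [[c [[c_chamber c_inj c_surj] cE]]|[g [g_inj g_cells gE]]].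
  have /choice[g gP] : forall a, exists S, S \in cells /\ c a = closed_cell S.
    by move=> a; have /chambersP[S ? ?] := c_chamber a Logic.I; exists S.
  exists g; split.
  - move=> a b gab; apply: c_inj; rewrite ?inE //.
    by have [_ ->] := gP a; have [_ ->] := gP b; rewrite gab.
  - move=> S; split=> [Scell|[a <-]]; last by have [] := gP a.
    have [|a _ ca] := c_surj (closed_cell S); first by apply/chambersP; exists S.
    exists a; have [ga caE] := gP a.
    by apply: closed_cell_inj; rewrite // -caE.
  - move=> a b; have [ga ca] := gP a; have [gb cb] := gP b.
    by apply/idP/idP => [/cE|ab]; [|apply/cE]; rewrite ca cb chamber_leP.
have gcell a : g a \in cells by apply/g_cells; exists a.
exists (fun a => closed_cell (g a)); split; last first.
  by move=> a b; rewrite gE; split=> ?; apply/(chamber_leP (gcell a) (gcell b)).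
split.
- by move=> a _; apply/chambersP; exists (g a).
- by move=> a b _ _ /closed_cell_inj gab; apply/g_inj/gab.
- move=> _ /chambersP[S /g_cells[a <-] ->]; by exists a.
Qed.

Lemma bineighborly_lattice : bineighborly A fundamental ->
  exists (d : Order.disp_t) (L : finLatticeType d),
    chamber_poset_iso A fundamental L /\ semidistributive L.
Proof.
move=> /bineighborlyP binA.
have [|d [L [g [g_inj g_cells gE sdL]]]] :=
  polygonal_family_lattice cells0 cellsC cells_step.
  move=> S h k Scell hS kS hk hcell kcell.
  by apply: cells_polygon => //; apply: binA.
by exists d, L; split=> //; apply/chamber_poset_isoP; exists g.
Qed.

(** Let a and b be the chambers across the upper walls h and k of c.  The
    interval from c to the join of a and b has no other atom, since the join of
    a and b is already its top.  As atoms are the chambers across upper walls,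
    h and k are the only facets of c separating it from this top, and
    incident_of_upper_facets applies. *)
Lemma bineighborly_of_crosscut (d : Order.disp_t) (L : finLatticeType d) :
  chamber_poset_iso A fundamental L -> crosscut_simplicial L ->
  bineighborly A fundamental.
Proof.
move=> /chamber_poset_isoP[g [g_inj g_cells gE]] crosscutL.
apply/bineighborlyP => S h k Scell hS kS hk hcell kcell.
have [[[c gc] [a ga]] [b gb]] := (iffLR (g_cells _) Scell,
  iffLR (g_cells _) hcell, iffLR (g_cells _) kcell).
have gcell (x : L) : g x \in cells by apply/g_cells; exists x.
have gltE (x y : L) : (x < y)%O = (g x \proper g y).
  by rewrite lt_leAnge !gE.
have coverP i (x : L) : i \notin S -> g x = (i |: S)%SET -> covers c x.
  move=> iS gx; rewrite /covers gltE gx gc finset.properUr; last first.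
    by rewrite finset.sub1set.
  apply/forallP => y; rewrite !gltE gx gc; apply/negP => /andP[Sy yiS].
  have := proper_card Sy; rewrite ltnNge => /negP; apply.
  by have := proper_card yiS; rewrite finset.cardsU1 iS add1n ltnS.
have ac : covers c a by apply: coverP ga.
have bc : covers c b by apply: coverP gb.
set j := Order.join a b.
have subS (x y : L) : (x <= y)%O -> g x \subset g y by rewrite gE.
have caj : (c <= j)%O.
  by have /andP[/ltW ca _] := ac; apply: le_trans ca (leUl _ _).
apply: (@incident_of_upper_facets S (g j)) => //.
- by rewrite -gc subS.
- by have /fintype.subsetP := subS _ _ (leUl a b); apply; rewrite ga finset.setU11.
- by have /fintype.subsetP := subS _ _ (leUr b a); apply; rewrite gb finset.setU11.
move=> i iS icell ij; have [x gx] := iffLR (g_cells _) icell.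
apply/negPn/negP => i_hk.
have jumpE l (y : L) : g y = (l |: S)%SET -> x = y -> i = l.
  move=> gy xy; have := finset.setU11 i S; rewrite -gx xy gy finset.in_setU1.
  by rewrite (negbTE iS) orbF => /eqP.
apply: (crosscutL c j caj [set a; b]%SET).
  apply/fintype.properP; split.
    apply/fintype.subsetP => y; rewrite !finset.inE => /orP[] /eqP ->.
      by rewrite ac leUl.
    by rewrite bc leUr.
  exists x; first by rewrite finset.inE (coverP i) // gE gx finset.subUset
    finset.sub1set ij -gc subS.
  apply: contra i_hk; rewrite !finset.inE.
  by move=> /orP[] /eqP xy; [rewrite (jumpE h a)|rewrite (jumpE k b)];
    rewrite ?eqxx ?orbT.
apply: le_anti; apply/andP; split; last first.
  by rewrite leUx !le_bigjoin // !finset.inE eqxx ?orbT.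
apply: (big_ind (fun y : L => y <= j)%O) => // [y z yj zj|y].
  by rewrite leUx yj zj.
by rewrite !finset.inE => /orP[] /eqP ->; rewrite ?leUl ?leUr.
Qed.

End Arrangement.
End SignedForms.

(** * Orienting the hyperplanes *)
Section DefiningForms.
Variables (R : realType) (n : nat).
Local Notation V := 'rV[R]_n.

(** The coordinate along v of the projection onto the line of v parallel to H;
    multiplying it by its value at v makes it positive there. *)
Lemma defining_form (H : {vspace V}) (v : V) : (\dim H).+1 = n -> v \notin H ->
  exists g : 'Hom(V, R^o), lker g = H /\ 0 < (g v : R).
Proof.
move=> dimH vH.
have v_neq0 : v != 0 by apply: contraNneq vH => ->; apply: mem0v.
have disj : (<[v]> :&: H = 0)%VS.
  apply/eqP; rewrite -subv0; apply/subvP => u; rewrite memv_cap memv0.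
  move=> /andP[/vlineP[r ->]]; have [->|r0] := eqVneq r 0; first by rewrite scale0r.
  by rewrite rpredZeq (negbTE r0) (negbTE vH).
have full : (<[v]> + H = fullv)%VS.
  apply/eqP; rewrite eqEdim subvf dimvf dimv_disjoint_sum // dim_vline v_neq0.
  by rewrite add1n dimH -[leqRHS]mul1n leqnn.
pose p := daddv_pi <[v]> H; pose q := daddv_pi H <[v]>.
have pqE u : p u + q u = u by apply: daddv_pi_add; rewrite ?full ?memvf.
pose x := [tuple v].
pose g : 'Hom(V, R^o) := linfun (coord x ord0 \o p).
have gE u : g u = coord x ord0 (p u) by rewrite lfunE.
have pE u : p u = (g u : R) *: v.
  have : p u \in <<x>>%VS by rewrite span_seq1 memv_pi.
  by move=> /coord_span; rewrite big_ord1 /= -gE.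
have gker u : (g u == 0) = (u \in H).
  apply/idP/idP => [/eqP gu|uH].
    by rewrite -[u]pqE pE gu scale0r add0r memv_pi.
  have : p u \in (<[v]> :&: H)%VS.
    rewrite memv_cap memv_pi /=; have -> : p u = u - q u by rewrite -{2}[u]pqE addrK.
    by rewrite rpredB // memv_pi.
  by rewrite disj memv0 pE scaler_eq0 (negbTE v_neq0) orbF.
have gv : (g v : R) != 0 by rewrite gker.
exists ((g v : R) *: g); split.
  by apply/vspaceP => u; rewrite memv_ker scale_lfunE scaler_eq0 (negbTE gv) gker.
rewrite scale_lfunE /GRing.scale /= -expr2 lt_neqAle sqr_ge0 andbT.
by rewrite eq_sym sqrf_eq0.
Qed.

Lemma arrangement_forms (A : set {vspace V}) (c0 : set V) :
    arrangement A -> chambers A c0 ->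
  exists (I : finType) (f : I -> 'Hom(V, R^o)) (v0 : V),
    [/\ forall i, 0 < (f i v0 : R),
        forall i j, i != j -> exists2 v, f i v = 0 & f j v != 0,
        A = range (fun i => lker (f i)) &
        c0 = closed_cell f finset.set0].
Proof.
move=> [/finite_seqP[s As] dimA] [v0 v0A c0E].
have /choice[f fP] : forall i : seq_sub s, exists g : 'Hom(V, R^o),
    lker g = val i /\ 0 < (g v0 : R).
  move=> i; have Ai : A (val i) by rewrite As; apply: valP.
  apply: defining_form; first exact: dimA.
  by apply/negP => iv; apply: v0A; exists (val i).
have f_v0 i : 0 < (f i v0 : R) by have [] := fP i.
have AE : A = range (fun i => lker (f i)).
  rewrite As; apply/seteqP; split=> [H Hs|_ [i _ <-]] /=.
    by exists (SeqSub Hs) => //; have [] := fP (SeqSub Hs).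
  by have [-> _] := fP i; apply: valP.
have f_indep i j : i != j -> exists2 v, f i v = 0 & f j v != 0.
  move=> ij; have [] := boolP (lker (f i) <= lker (f j))%VS; last first.
    by move=> /subvPn[v]; rewrite !memv_ker => /eqP; exists v.
  have dimf k : (\dim (lker (f k))).+1 = n by apply: dimA; rewrite AE; exists k.
  move=> sub; suff : lker (f i) == lker (f j).
    have [-> _] := fP i; have [-> _] := fP j.
    by move=> /eqP/val_inj eq_ij; rewrite eq_ij eqxx in ij.
  by rewrite eqEdim sub -ltnS !dimf leqnn.
exists (seq_sub s), f, v0; split=> //.
have v0_cell : open_cell f finset.set0 v0 by move=> i; rewrite sgf_notin ?inE.
rewrite -c0E AE (component_open_cell v0_cell) closure_open_cell //.
exact: cells0 f_v0.
Qed.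

End DefiningForms.

Theorem theorem1p3 (R : realType) (n : nat) (A : set {vspace 'rV[R]_n})
    (c0 : set 'rV[R]_n) (hA : arrangement A) (hc0 : chambers A c0) :
  [<-> exists (d : Order.disp_t) (L : finLatticeType d),
         chamber_poset_iso A c0 L /\ crosscut_simplicial L;
       exists (d : Order.disp_t) (L : finLatticeType d),
         chamber_poset_iso A c0 L /\ semidistributive L;
       bineighborly A c0].
Proof.
have [I [f [v0 [f_v0 f_indep -> ->]]]] := arrangement_forms hA hc0.
tfae.
- move=> [d [L [isoL ccL]]]; apply: (bineighborly_lattice f_v0 f_indep).
  exact: bineighborly_of_crosscut isoL ccL.
- move=> [d [L [isoL [msdL _]]]].
  apply: (bineighborly_of_crosscut f_v0 f_indep isoL).
  exact: crosscut_of_meet_semidistributive.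
- move=> /(bineighborly_lattice f_v0 f_indep)[d [L [isoL [msdL _]]]].
  by exists d, L; split=> //; apply: crosscut_of_meet_semidistributive.
Qed.
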